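(* Let $w$ be a 2D word of size $(m,n)$. Then $0\le|PALConj(w)|\le 4$ if $m$ and $n$ are both even, $0\le|PALConj(w)|\le 1$ if $m$ and $n$ are both odd, and $0\le|PALConj(w)|\le 2$ otherwise.
   Context: A 2D word of size $(m,n)$ over a finite alphabet is an $m\times n$ array $w$ with rows $u_1,\dots,u_m$ and columns $v_1,\dots,v_n$. Its reverse is $w^R=[w_{m-i+1,\,n-j+1}]_{i,j}$ and $w$ is a 2D palindrome if $w=w^R$. For $1\le k\le n$, the cyclic rotation of $k$ columns is the word $\circlearrowleft^{Col}_k w$ whose columns are, in order, $v_{n-k+1},\dots,v_n,v_1,\dots,v_{n-k}$; for $1\le k\le m$, the cyclic rotation of $k$ rows is the word $\circlearrowleft^{Row}_k w$ whose rows are, in order, $u_{m-k+1},\dots,u_m,u_1,\dots,u_{m-k}$. The conjugacy class of $w$ is $Conj(w)=\{\circlearrowleft^{Col}_i\circlearrowleft^{Row}_j w : 1\le i\le n,\ 1\le j\le m\}$, and $PALConj(w)$ is the set of elements of $Conj(w)$ that are 2D palindromes. *)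

(* Defs.v *)
From HB Require Import structures.
From mathcomp Require Import all_boot all_order all_algebra.

Set Implicit Arguments.
Unset Strict Implicit.
Unset Printing Implicit Defensive.

Section Words2D.

(* A 2D word of size (m, n) over the finite alphabet T is a matrix 'M[T]_(m, n),
   with indices starting at 0; degenerate sizes (m = 0 or n = 0) are allowed. *)
Variables (T : finType) (m n : nat).
Implicit Type w : 'M[T]_(m, n).

Definition rev2 w : 'M[T]_(m, n) := \matrix_(i, j) w (rev_ord i) (rev_ord j).

Definition palindrome2 w : bool := w == rev2 w.

(* For k <= n, rotr k sends the list of columns v_1, ..., v_n to
   v_(n-k+1), ..., v_n, v_1, ..., v_(n-k); likewise for rows. *)
Definition rot_cols (k : nat) w : 'M[T]_(m, n) :=
  colsub (tnth (rotr_tuple k (ord_tuple n))) w.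

Definition rot_rows (k : nat) w : 'M[T]_(m, n) :=
  rowsub (tnth (rotr_tuple k (ord_tuple m))) w.

(* The rotation amounts i.+1 and j.+1 run over 1, ..., n and 1, ..., m. *)
Definition Conj w : {set 'M[T]_(m, n)} :=
  [set rot_cols i.+1 (rot_rows j.+1 w) | i : 'I_n, j : 'I_m].

Definition PALConj w : {set 'M[T]_(m, n)} := [set v in Conj w | palindrome2 v].

End Words2D.

(* Main.v *)
Require Import Defs.
From HB Require Import structures.
From mathcomp Require Import all_boot all_order all_algebra.

(** Rotations make G = Z/m x Z/n act on the words of size (m, n), and reversing
    a word turns rotation by g into rotation by -g.  Hence, if v is a palindrome
    with stabilizer S, its rotation by g is a palindrome iff 2g lies in S.  The
    set H of such g is the preimage of S under doubling, so |H| <= |S| |G[2]|,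
    while each palindrome conjugate to v comes from |S| elements of H: there are
    at most |G[2]| = gcd(2, m) gcd(2, n) of them. *)

Set Implicit Arguments.
Unset Strict Implicit.
Unset Printing Implicit Defensive.

Import GRing.Theory.

Lemma card_fibers_le (I J : finType) (A : {set I}) (B : {set J}) (f : I -> J)
    (k : nat) :
  (forall x, x \in A -> f x \in B) ->
  (forall y, y \in B -> #|[set x in A | f x == y]| <= k) -> #|A| <= #|B| * k.
Proof.
move=> AB le_k; rewrite -sum1_card (partition_big f (mem B)) //= -sum_nat_const.
apply: leq_sum => y By; apply: leq_trans (le_k y By).
by rewrite -sum1_card; apply: eq_leq; apply: eq_bigl => x; rewrite inE.
Qed.

Lemma card_fibers_ge (I J : finType) (A : {set I}) (B : {set J}) (f : I -> J)
    (k : nat) :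
  (forall x, x \in A -> f x \in B) ->
  (forall y, y \in B -> k <= #|[set x in A | f x == y]|) -> #|B| * k <= #|A|.
Proof.
move=> AB ge_k; rewrite -[#|A|]sum1_card (partition_big f (mem B)) //=.
rewrite -sum_nat_const; apply: leq_sum => y By; apply: leq_trans (ge_k y By) _.
by rewrite -sum1_card; apply: eq_leq; apply: eq_bigl => x; rewrite inE.
Qed.

Section InvertedAction.

Local Open Scope ring_scope.

Variables (G : finZmodType) (X : finType) (act : G -> X -> X) (rev : X -> X).
Hypothesis act0 : forall x, act 0 x = x.
Hypothesis actD : forall g h x, act (g + h) x = act g (act h x).
Hypothesis rev_act : forall g x, rev (act g x) = act (- g) (rev x).

Lemma card_rev_fixed_orbit (x : X) : rev x = x ->
  (#|[set y in [set act g x | g : G] | y == rev y]|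
     <= #|[set g : G | (g + g == 0)%R]|)%N.
Proof.
move=> rev_x; set P := [set y in _ | _]; set K := [set g | _].
pose S := [set g | act g x == x].
pose H := [set g | g + g \in S].
have S_gt0 : (0 < #|S|)%N by apply/card_gt0P; exists 0; rewrite inE act0.
have fixedE g : (act g x == rev (act g x)) = (g \in H).
  rewrite rev_act rev_x !inE actD; apply/eqP/eqP => [-> | E].
    by rewrite -actD subrr act0.
  by rewrite -{2}E -actD addNr act0.
have PH : (#|P| * #|S| <= #|H|)%N.
  apply: (@card_fibers_ge _ _ H P (act^~ x)) => [g Hg | y].
    by rewrite inE fixedE Hg andbT imset_f.
  rewrite inE => /andP[/imsetP[g _ ->]]; rewrite fixedE => Hg.
  (* The fibre over [act g x] contains the whole coset g + S. *)
  rewrite -(card_imset (mem S) (addrI g)); apply/subset_leq_card/subsetP => h.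
  case/imsetP=> s; rewrite inE => /eqP s_x ->.
  by rewrite inE -fixedE !actD s_x fixedE Hg eqxx.
have HK : (#|H| <= #|S| * #|K|)%N.
  apply: (@card_fibers_le _ _ H S (fun g => g + g)) => [g | s _].
    by rewrite inE.
  (* A nonempty fibre of doubling lies in the translate of [K] by any one of its points [g0]. *)
  have [-> | [g0]] := set_0Vmem [set g in H | g + g == s].
    by rewrite cards0.
  rewrite inE => /andP[_ /eqP g0_s].
  rewrite -(card_imset (mem K) (addIr g0)); apply/subset_leq_card/subsetP => h.
  rewrite inE => /andP[_ /eqP h_s]; apply/imsetP; exists (h - g0).
    by rewrite inE addrACA h_s -g0_s -opprD subrr.
  by rewrite subrK.
by rewrite -(leq_pmul2r S_gt0) (mulnC #|K|) (leq_trans PH).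
Qed.

End InvertedAction.

(** If m+1 divides 2x < 2(m+1), the quotient is 0 or 1, and 1 forces m+1 to be even. The bound is
    gcd(2, m+1). *)
Lemma card_Zp_2torsion (m : nat) :
  #|[set x : 'I_m.+1 | (x + x)%R == 0%R]| <= 2 - odd m.+1.
Proof.
set K := [set x | _].
have KE x : x \in K -> x = ord0 \/ x.*2 = m.+1.
  rewrite inE -val_eqE /= addnn -[_ == _]/(m.+1 %| x.*2) => /dvdnP[[|[|q]] E].
  - by left; apply/val_inj/eqP; rewrite -double_eq0 E.
  - by right; rewrite E mul1n.
  - have: x.*2 < 2 * m.+1 by rewrite -mul2n ltn_pmul2l.
    by rewrite E ltn_pmul2r.
case: (boolP (odd m.+1)) => odd_m.
  rewrite -[2 - true]/1 -(cards1 (ord0 : 'I_m.+1)).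
  apply/subset_leq_card/subsetP => x /KE[-> | E]; first by rewrite inE.
  by rewrite -E odd_double in odd_m.
rewrite (leq_trans (subset_leq_card (_ : K \subset [set ord0; inord m.+1./2])))
  ?cards2 ?ltnS ?leq_b1 //.
apply/subsetP => x /KE[-> | E]; rewrite !inE ?eqxx //.
by rewrite (congr1 half (esym E)) doubleK inord_val eqxx orbT.
Qed.

(** Joins the finite and additive structures, so that Z/m x Z/n can serve as the acting group. *)
HB.instance Definition _ (A B : finZmodType) := GRing.Zmodule.on (A * B)%type.

Section Rotations.

Local Open Scope ring_scope.

Variables (T : finType) (m n : nat).
Implicit Type w : 'M[T]_(m.+1, n.+1).

(** Index addition is modular, which does the wrapping around; the sign is opposite to that of
    [rot_rows] and [rot_cols]. *)
Definition rot2 (g : 'I_m.+1 * 'I_n.+1) w : 'M[T]_(m.+1, n.+1) :=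
  \matrix_(i, j) w (i + g.1) (j + g.2).

Lemma rot20 w : rot2 0 w = w.
Proof. by apply/matrixP => i j; rewrite mxE !addr0. Qed.

Lemma rot2D g h w : rot2 (g + h) w = rot2 g (rot2 h w).
Proof. by apply/matrixP => i j; rewrite !mxE !addrA. Qed.

(** As [ord_max] is -1 modulo p+1, reversal is a reflection of Z/(p+1), and so it inverts
    translations. *)
Lemma rev_ordE (p : nat) (i : 'I_p.+1) : rev_ord i = - i + ord_max.
Proof.
apply: (canRL (addKr i)); apply: val_inj.
by rewrite /= subSS subnKC ?modn_small // -ltnS.
Qed.

Lemma rev2_rot2 g w : rev2 (rot2 g w) = rot2 (- g) (rev2 w).
Proof.
have oppE (p : nat) (a b : 'I_p.+1) :
    - a + ord_max + b = - (a + - b) + ord_max.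
  by rewrite opprB addrAC (addrC b).
by apply/matrixP => i j; rewrite !mxE !rev_ordE !oppE.
Qed.

Lemma tnth_rotr_ord (p : nat) (k i : 'I_p.+1) :
  tnth (rotr_tuple k.+1 (ord_tuple p.+1)) i = i - inZp k.+1.
Proof.
apply: (canRL (addrK _)); apply: val_inj.
rewrite (tnth_nth ord0) /= modnDmr /rotr size_enum_ord /rot subSS.
have k_le : (k <= p)%N by rewrite -ltnS.
rewrite nth_cat size_drop size_enum_ord subSn ?leq_subr // subKn //.
(* The first [k.+1] entries come from the end of the list, where adding [k.+1] wraps around once;
   the others do not wrap. *)
case: ltnP => i_k.
  rewrite nth_drop nth_enum_ord; last first.
    by rewrite ltnS -[leqRHS](subnK k_le) leq_add2l -ltnS.
  by rewrite addnAC addnS subnK // modnDl modn_small.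
rewrite nth_take ?nth_enum_ord ?subnK ?modn_small //.
  by rewrite (leq_ltn_trans (leq_subr _ _)).
by rewrite -(ltn_add2r k.+1) subnK // addnS subnK.
Qed.

Lemma Conj_rot2 w v : v \in Conj w -> exists g, v = rot2 g w.
Proof.
case/imset2P => i j _ _ ->; exists (- inZp j.+1, - inZp i.+1).
by apply/matrixP => a b; rewrite !mxE !tnth_rotr_ord.
Qed.

Lemma card_PALConj_le w :
  (#|PALConj w| <= (2 - odd m.+1) * (2 - odd n.+1))%N.
Proof.
have [-> | [v]] := set_0Vmem (PALConj w); first by rewrite cards0.
(* The base point of the orbit is moved from [w] to a palindrome [v], which [rev2] fixes. *)
rewrite inE => /andP[/Conj_rot2[g v_g] /eqP pal_v].
apply: (@leq_trans #|[set h : 'I_m.+1 * 'I_n.+1 | h + h == 0]|); last first.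
  apply: leq_trans (leq_mul (card_Zp_2torsion m) (card_Zp_2torsion n)).
  rewrite -cardsX; apply/subset_leq_card/subsetP => h.
  by rewrite !inE.
apply: leq_trans (card_rev_fixed_orbit rot20 rot2D rev2_rot2 (esym pal_v)).
apply/subset_leq_card/subsetP => u; rewrite !inE => /andP[/Conj_rot2[h ->] pal_h].
apply/andP; split=> //; apply/imsetP; exists (h - g) => //.
by rewrite v_g -rot2D subrK.
Qed.

End Rotations.

Theorem theorem4p8 (T : finType) (m n : nat) (w : 'M[T]_(m, n)) :
  [/\ ~~ odd m && ~~ odd n -> 0 <= #|PALConj w| <= 4,
      odd m && odd n -> 0 <= #|PALConj w| <= 1
    & ~~ (~~ odd m && ~~ odd n) && ~~ (odd m && odd n) ->
      0 <= #|PALConj w| <= 2].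
Proof.
have le_PAL : #|PALConj w| <= (2 - odd m) * (2 - odd n).
  (* In a degenerate size there is no rotation amount to choose, so even [Conj w] is empty. *)
  have PAL0 : m = 0 \/ n = 0 -> #|PALConj w| = 0.
    move=> mn0; apply: eq_card0 => v; rewrite inE; apply/negP.
    case/andP=> /imset2P[j i _ _ _] _.
    by case: mn0 => mn0; [move: i | move: j]; rewrite mn0 => -[].
  case: m w PAL0 => [|m'] w PAL0; first by rewrite PAL0 //; left.
  case: n w PAL0 => [|n'] w PAL0; first by rewrite PAL0 //; right.
  exact: card_PALConj_le.
by move: le_PAL; case: (odd m); case: (odd n).
Qed.
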